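(* Let $\boldsymbol\gamma=\{\gamma_n\}_{n=0}^{\infty}$ be a sequence of real numbers such that $\inf_{n\in\mathbb{Z}_+}\gamma_n>-\infty$. Then the following statements are equivalent: (i) $\boldsymbol\gamma$ is CPD, $\sup_{n\in\mathbb{Z}_+}(\gamma_{n+1}-\gamma_n)<\infty$ and $\operatorname{supp}(\nu)\subseteq\mathbb{R}_+$, where $\nu$ is the measure appearing in the representing triplet of $\boldsymbol\gamma$; (ii) there exist a finite Borel measure $\nu$ on $\mathbb{R}$ and $d\in\mathbb{R}$ such that (ii-a) $\nu(\mathbb{R}\setminus[0,1))=0$, (ii-b) $\frac{1}{1-x}\in L^1(\nu)$, (ii-c) $\gamma_n=\gamma_0+nd-\int_{[0,1)}\frac{1-x^n}{(1-x)^2}\,\mathrm{d}\nu(x)$ for all $n\in\mathbb{Z}_+$. Moreover, the following statements are satisfied: (iii) if (i) holds and $(b,c,\nu)$ is the representing triplet of $\boldsymbol\gamma$, then $c=0$, $\frac{1}{1-x}\in L^1(\nu)$ and the pair $(d,\nu)$ with $d=b+\int_{[0,1)}\frac{1}{1-x}\,\mathrm{d}\nu(x)$ is the unique pair satisfying (ii); (iv) if (ii) holds, then $d\geq0$, the sequence $\triangle\boldsymbol\gamma=\{\gamma_{n+1}-\gamma_n\}_{n=0}^\infty$ is monotonically increasing to $d$, and $(b,0,\nu)$ is the representing triplet of $\boldsymbol\gamma$ with $b=d-\int_{[0,1)}\frac{1}{1-x}\,\mathrm{d}\nu(x)$.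
   Context: $\mathbb{Z}_+=\{0,1,2,\ldots\}$, $\mathbb{R}_+=[0,\infty)$; measures are positive; $\operatorname{supp}(\nu)$ is the closed support; ''monotonically increasing'' means nondecreasing. A real sequence $\{\gamma_n\}_{n=0}^\infty$ is conditionally positive definite (CPD) if $\sum_{i,j=0}^k \gamma_{i+j}\lambda_i\bar\lambda_j\geq 0$ for all finite complex sequences $\lambda_0,\ldots,\lambda_k$ with $\sum_{i=0}^k\lambda_i=0$. Let $Q_0=Q_1=0$ and $Q_n(x)=\sum_{j=0}^{n-2}(n-j-1)x^j$ for $n\geq2$. For a CPD sequence with $\limsup_{n\to\infty}|\gamma_n|^{1/n}<\infty$ there is a unique triplet $(b,c,\nu)$, called its representing triplet, with $b\in\mathbb{R}$, $c\in\mathbb{R}_+$ and $\nu$ a finite compactly supported Borel measure on $\mathbb{R}$ with $\nu(\{1\})=0$, such that $\gamma_n=\gamma_0+bn+cn^2+\int_{\mathbb{R}}Q_n\,\mathrm{d}\nu$ for all $n\in\mathbb{Z}_+$. (The conditions $\inf_n\gamma_n>-\infty$ and $\sup_n(\gamma_{n+1}-\gamma_n)<\infty$ imply $\limsup_{n\to\infty}|\gamma_n|^{1/n}\leq1$, so in (i) the representing triplet exists.) *)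

(* Defs.v *)
From HB Require Import structures.
From mathcomp Require Import all_boot all_order all_algebra.
From mathcomp Require Import all_classical all_reals all_analysis.
From mathcomp Require Import complex.

Set Implicit Arguments.
Unset Strict Implicit.
Unset Printing Implicit Defensive.

Import Order.TTheory GRing.Theory Num.Theory.
Import numFieldNormedType.Exports.

Local Open Scope classical_set_scope.
Local Open Scope ring_scope.

(* In R[i], [0 <= z] means that z is real and nonnegative. *)
Definition cond_pos_def (R : realType) (gamma : nat -> R) : Prop :=
  forall (k : nat) (lambda : 'I_k.+1 -> R[i]),
    \sum_(i < k.+1) lambda i = 0 ->
    0 <= \sum_(i < k.+1) \sum_(j < k.+1)
           (gamma (i + j)%N)%:C%C * lambda i * (lambda j)^*%C.

(* The empty sum for n = 0, 1; in the range of summation the subtraction of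
   naturals does not truncate. *)
Definition Qfun (R : realType) (n : nat) (x : R) : R :=
  \sum_(j < n.-1) (n - j - 1)%:R * x ^+ j.

Notation borel_finite_measure R :=
  ({finite_measure set (measurableTypeR R) -> \bar R}).

(* A measure is determined on Borel sets only: its values elsewhere are junk,
   so Leibniz equality would be too strong. *)
Definition borel_eq (R : realType) (mu nu : borel_finite_measure R) : Prop :=
  forall A : set (measurableTypeR R), measurable A -> mu A = nu A.

Definition closed_support (R : realType) (nu : borel_finite_measure R) :
    set R :=
  \bigcap_(F in [set F : set R | closed F /\ nu (~` F) = 0%E]) F.

(* By the theorem on representing triplets a triplet as below is unique (nu
   being taken up to [borel_eq]), and exists exactly when gamma is conditionally
   positive definite of at most exponential growth.  The integrand is bounded
   on the compact support of nu, hence integrable. *)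
Definition representing_triplet (R : realType) (gamma : nat -> R)
    (b c : R) (nu : borel_finite_measure R) : Prop :=
  [/\ 0 <= c,
      compact (closed_support nu),
      nu [set 1] = 0%E &
      forall n : nat,
        gamma n = gamma 0%N + b * n%:R + c * n%:R ^+ 2
                  + \int[nu]_(x in setT) Qfun n x].

Definition cpd_bounded_supp (R : realType) (gamma : nat -> R) : Prop :=
  [/\ cond_pos_def gamma,
      has_ubound (range (fun n => gamma n.+1 - gamma n)) &
      exists (b c : R) (nu : borel_finite_measure R),
        representing_triplet gamma b c nu /\
        closed_support nu `<=` [set x | 0 <= x]].

(* 1 / (1 - x) has the value 0 at x = 1, which is a nu-null point wherever this
   is combined with nu (~` [0, 1[) = 0. *)
Definition inv_1subx_L1 (R : realType) (nu : borel_finite_measure R) : Prop :=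
  nu.-integrable setT (fun x : R => (1 / (1 - x))%:E).

Definition integral_rep (R : realType) (gamma : nat -> R)
    (d : R) (nu : borel_finite_measure R) : Prop :=
  [/\ nu (~` `[0, 1[) = 0%E,
      inv_1subx_L1 nu &
      forall n : nat,
        gamma n = gamma 0%N + n%:R * d
                  - \int[nu]_(x in `[0, 1[) ((1 - x ^+ n) / (1 - x) ^+ 2)].

(* Main.v *)
Require Import Defs.
From HB Require Import structures.
From mathcomp Require Import all_boot all_order all_algebra.
From mathcomp Require Import all_classical all_reals all_analysis.
From mathcomp Require Import measurable_realfun complex zify ring lra.

(* Since [Q_(n+1) - Q_n = \sum_(i < n) x^i], the first differences of gamma in
   a triplet (b, c, nu) are [b + c (2 n + 1) + \int \sum_(i < n) x^i dnu].  If
   supp(nu) is in [0, +oo[ and these are bounded above, then c = 0, nu has no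
   mass on [1, +oo[ (where the geometric sum is at least n), and monotone
   convergence makes 1 / (1 - x) integrable.  Conversely, (ii) gives
   [gamma_(n+1) - gamma_n = d - \int x^n / (1 - x) dnu], which increases to d by
   dominated convergence, and turns the quadratic form of gamma on sum-zero
   vectors into [\int (\sum_i a_i x^i)^2 / (1 - x)^2 dnu].
   Uniqueness: the second differences are the moments of [nu + 2 c delta_1], and
   the moments of a compactly supported measure determine its value on every ray
   ]-oo, t[, whose indicator is a bounded pointwise limit of polynomials. *)

Set Implicit Arguments.
Unset Strict Implicit.
Unset Printing Implicit Defensive.

Import Order.TTheory GRing.Theory Num.Theory.
Import numFieldNormedType.Exports.

Local Open Scope classical_set_scope.
Local Open Scope ring_scope.

(** * Null sets and integrals over sets of full measure *)

(** The line has a countable base: every point off the support lies in an open interval with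
    rational endpoints that is [nu]-null, and countably many such intervals have a null union. *)
Lemma closed_support_null (R : realType) (nu : borel_finite_measure R) :
  nu (~` closed_support nu) = 0%E.
Proof.
pose I (r : rat * rat) : set R := `](ratr r.1 : R), (ratr r.2 : R)[%classic.
pose J r := if nu (I r) == 0%E then I r else set0.
pose F n : set R := oapp J set0 (unpickle n).
have Fn n : nu.-negligible (F n).
  rewrite /F; case: unpickle => [r|]; last exact: negligible_set0.
  rewrite /= /J; case: eqP => [I0|_]; last exact: negligible_set0.
  by apply/negligibleP => //; exact: measurable_itv.
have JF r : J r `<=` \bigcup_n F n.
  move=> x Jx; exists (pickle r); first by [].
  by rewrite /F pickleK.
have sF : ~` closed_support nu `<=` \bigcup_n F n.
  move=> x; move/existsNP => -[G /not_implyP[[cG G0] Gx]].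
  have : nbhs x (~` G) by apply: open_nbhs_nbhs; split => //; exact: closed_openC.
  rewrite -nbhs_ballE => -[e /= e0 eG].
  have [p] : exists p, ratr p \in `]x - e, x[ by apply: rat_in_itvoo; rewrite ltrBlDr ltrDl.
  rewrite in_itv/= => /andP[xp px].
  have [q] : exists q, ratr q \in `]x, x + e[ by apply: rat_in_itvoo; rewrite ltrDl.
  rewrite in_itv/= => /andP[xq qx].
  have pqG : `](ratr p : R), ratr q[ `<=` ~` G.
    move=> y; rewrite /= in_itv/= => /andP[py yq]; apply: eG; rewrite /ball/= ltr_distlC.
    by rewrite (lt_trans xp py) (lt_trans yq qx).
  apply: (JF (p, q)).
  rewrite /J ifT /I /=; first by rewrite in_itv/= px xq.
  rewrite -measure_le0 -G0; apply: le_measure => //; rewrite inE.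
    exact: measurable_itv.
  by apply: measurableC; exact: closed_measurable.
have cS : closed (closed_support nu) by apply: closed_bigI => G [].
apply/negligibleP; first by apply: measurableC; exact: closed_measurable.
by apply: (@negligibleS _ _ _ nu _ _ sF); apply: negligible_bigcup.
Qed.

(** Trades inclusions of supports for null complements, the form in which integrals can be
    restricted. *)
Lemma closed_support_subP (R : realType) (nu : borel_finite_measure R)
    (F : set R) : closed F ->
  closed_support nu `<=` F <-> nu (~` F) = 0%E.
Proof.
move=> cF; split=> [sF|F0]; last by apply: bigcap_inf.
apply/eqP; rewrite -measure_le0 -(closed_support_null nu) le_measure// ?inE.
- by apply: measurableC; exact: closed_measurable.
- apply: measurableC; apply: closed_measurable.
  by apply: closed_bigI => G [].
- exact: subsetC.
Qed.

Section full_set.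
Context (R : realType) (nu : borel_finite_measure R).
Variables (A : set (measurableTypeR R)) (mA : measurable A)
  (A0 : nu (~` A) = 0%E).
Implicit Types f g : measurableTypeR R -> R.

Lemma integrable_full f : measurable_fun setT f ->
  nu.-integrable A (EFin \o f) -> nu.-integrable setT (EFin \o f).
Proof.
move=> mf intf; apply/(negligible_integrable _ _ _ A0) => //.
- exact: measurableC.
- exact/measurable_EFinP.
- by rewrite setTD setCK.
Qed.

Lemma bounded_integrable_full f C : measurable_fun setT f ->
  (forall x, A x -> `|f x| <= C) -> nu.-integrable setT (EFin \o f).
Proof.
move=> mf fC; apply: integrable_full => //.
apply: measurable_bounded_integrable => //.
- by rewrite ltey_eq fin_num_measure.
- exact: measurable_funS mf.
- exists C; split; first exact: num_real.
  by move=> y Cy x Ax; apply: le_trans (ltW Cy); exact: fC.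
Qed.

(** Bridges the integrals over the whole line in [representing_triplet] and those over [[0, 1[] in
    [integral_rep]. *)
Lemma Rintegral_full f : nu.-integrable setT (EFin \o f) ->
  \int[nu]_(x in A) f x = \int[nu]_x f x.
Proof.
move=> intf; rewrite /Rintegral [in RHS](negligible_integral _ _ _ A0)//.
  by rewrite setTD setCK.
exact: measurableC.
Qed.

Lemma dominated_cvg_Rintegral (f_ : nat -> measurableTypeR R -> R) f g :
  (forall n, measurable_fun A (f_ n)) -> measurable_fun A f ->
  nu.-integrable A (EFin \o g) ->
  (forall n x, A x -> `|f_ n x| <= g x) ->
  (forall x, A x -> f_ n x @[n --> \oo] --> f x) ->
  \int[nu]_(x in A) f_ n x @[n --> \oo] --> \int[nu]_(x in A) f x.
Proof.
move=> mf_ mf intg f_g f_f.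
have [||||intf _ h] := @dominated_convergence _ _ R nu A mA
  (fun n => EFin \o f_ n) (EFin \o f) (EFin \o g) _ _ _ intg.
- by move=> n; apply/measurable_EFinP.
- exact/measurable_EFinP.
- by apply: aeW => x Ax; apply: cvg_EFin; [exact: nearW|exact: f_f].
- by apply: aeW => x n Ax; rewrite lee_fin; exact: f_g.
apply: fine_cvg; rewrite fineK; first exact: h.
exact: integrable_fin_num.
Qed.

End full_set.

(** * Geometric sums and the functions Q_n *)

Lemma geom_sumE (F : fieldType) (x : F) n :
  x != 1 -> \sum_(i < n) x ^+ i = (1 - x ^+ n) / (1 - x).
Proof.
move=> x1; have x1' : 1 - x != 0 by rewrite subr_eq0 eq_sym.
by apply: (canRL (mulfK x1')); rewrite -[in RHS]opprB subrX1; ring.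
Qed.

Lemma Qfun0 (R : realType) (x : R) : Qfun 0 x = 0.
Proof. by rewrite /Qfun big_ord0. Qed.

Lemma QfunS (R : realType) n (x : R) :
  Qfun n.+1 x = Qfun n x + \sum_(i < n) x ^+ i.
Proof.
case: n => [|m]; first by rewrite /Qfun /= !big_ord0 addr0.
rewrite /Qfun /= !big_ord_recr /= addrA -big_split /=.
congr (_ + _); last by rewrite (_ : (m.+2 - m - 1 = 1)%N) ?mul1r //; lia.
apply: eq_bigr => j _; rewrite -[X in _ = _ + X]mul1r -mulrDl natr1.
by congr (_%:R * _); have := ltn_ord j; lia.
Qed.

Lemma QfunE (R : realType) n (x : R) : x != 1 ->
  Qfun n x = n%:R / (1 - x) - (1 - x ^+ n) / (1 - x) ^+ 2.
Proof.
move=> x1; have x1' : 1 - x != 0 by rewrite subr_eq0 eq_sym.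
elim: n => [|n IH]; first by rewrite Qfun0 expr0 subrr !mul0r subr0.
by rewrite QfunS IH geom_sumE // (exprS x) -natr1; field.
Qed.

Lemma ge1_le_geom_sum (R : realDomainType) (x : R) n :
  1 <= x -> n%:R <= \sum_(i < n) x ^+ i.
Proof.
move=> x1; rewrite -[X in X%:R]card_ord -sumr_const; apply: ler_sum => i _.
exact: exprn_ege1.
Qed.

(** Each of the n terms of the geometric sum is at least z^n, and the sum is at most (1 - z)^-1. *)
Lemma natr_expr_le (R : realFieldType) (z : R) n :
  0 <= z < 1 -> n%:R * z ^+ n <= (1 - z)^-1.
Proof.
move=> /andP[z0 z1]; have z1' : 0 < 1 - z by rewrite subr_gt0.
apply: (@le_trans _ _ (\sum_(i < n) z ^+ i)).
  rewrite mulr_natl -[X in _ *+ X]card_ord -sumr_const; apply: ler_sum => i _.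
  by apply: ler_wiXn2l => //; [exact: ltW|exact: ltnW].
rewrite geom_sumE ?lt_eqF // ler_piMl //; first by rewrite invr_ge0 ltW.
by rewrite gerDl oppr_le0 exprn_ge0.
Qed.

(** * Bernoulli inequalities and the approximation of a step *)

Lemma bernoulli_ge (R : realDomainType) (u : R) m :
  0 <= u <= 1 -> 1 - m%:R * u <= (1 - u) ^+ m.
Proof.
move=> /andP[u0 u1]; elim: m => [|m IH]; first by rewrite mul0r subr0 expr0.
rewrite exprS -natr1; apply: le_trans (ler_wpM2l _ IH); last by rewrite subr_ge0.
rewrite -subr_ge0; have -> : (1 - u) * (1 - m%:R * u) - (1 - (m%:R + 1) * u) = m%:R * u ^+ 2 by ring.
by rewrite mulr_ge0 ?sqr_ge0.
Qed.

Lemma bernoulli_le (R : realFieldType) (u : R) m :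
  0 <= u <= 1 -> (1 - u) ^+ m <= (1 + m%:R * u)^-1.
Proof.
move=> /andP[u0 u1]; have mu0 : 0 < 1 + m%:R * u.
  by rewrite ltr_pwDl // mulr_ge0.
rewrite -div1r ler_pdivlMr //.
elim: m mu0 => [|m IH] mu0; first by rewrite expr0 mul0r addr0 mulr1.
apply: le_trans (IH _); last by rewrite ltr_pwDl // mulr_ge0.
rewrite exprSr -mulrA ler_wpM2l ?exprn_ge0 ?subr_ge0 //.
rewrite -subr_ge0 -natr1.
have -> : 1 + m%:R * u - (1 - u) * (1 + (m%:R + 1) * u) = (m%:R + 1) * u ^+ 2 by ring.
by rewrite mulr_ge0 ?sqr_ge0 // addr_ge0.
Qed.

(* Bernoulli's inequality gives the limits: [n 4^n y^(2 n)] is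
   [(n (2 y)^n) (2 y)^n], which tends to 0 if [y < 1/2] and is at least n
   otherwise, so there is no exceptional value at [y = 1/2]. *)
Definition step_approx (R : realType) n (y : R) : R :=
  (1 - y ^+ (2 * n)) ^+ (n * 4 ^ n).

Lemma step_approx_ge0_le1 (R : realType) n (y : R) :
  0 <= y <= 1 -> 0 <= step_approx n y <= 1.
Proof.
move=> /andP[y0 y1]; rewrite /step_approx.
have h : 0 <= y ^+ (2 * n) <= 1 by rewrite exprn_ge0 // exprn_ile1.
apply/andP; split; first by apply: exprn_ge0; lra.
by apply: exprn_ile1; lra.
Qed.

Lemma cvg_step_approx (R : realType) (y : R) : 0 <= y <= 1 ->
  step_approx n y @[n --> \oo] --> (if y < 2^-1 then 1 else 0 : R).
Proof.
move=> y01; have /andP[y0 y1] := y01; have h n : 0 <= y ^+ (2 * n) <= 1.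
  by rewrite exprn_ge0 // exprn_ile1.
(* This is the product m u of the Bernoulli inequalities for u = y^(2 n) and m = n 4^n. *)
have e n : (n * 4 ^ n)%:R * y ^+ (2 * n) = (n%:R * (2 * y) ^+ n) * (2 * y) ^+ n.
  rewrite natrM -!mulrA; congr (_ * _).
  rewrite -exprD addnn -mul2n exprMn; congr (_ * _).
  by rewrite natrX exprM -(natrX R 2 2).
case: ifPn => [y2|].
  (* For z = 2 y < 1, [natr_expr_le] bounds m u = (n z^n) z^n by (1 - z)^-1 z^n, which tends to
     0. *)
  have z1 : 0 <= 2 * y < 1 by apply/andP; split; lra.
  apply: (squeeze_cvgr (h := cst 1)
    (f := fun n => 1 - (1 - 2 * y)^-1 * (2 * y) ^+ n)).
  - apply: nearW => n; apply/andP; split; last first.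
      by have /andP[] := step_approx_ge0_le1 n y01.
    apply: le_trans (bernoulli_ge _ (h n)).
    rewrite lerD2l lerN2 e ler_wpM2r //; last exact: natr_expr_le.
    by rewrite exprn_ge0 //; case/andP: z1.
  - rewrite -[X in _ --> X]subr0 -(mulr0 (1 - 2 * y)^-1).
    apply: cvgB; first exact: cvg_cst.
    apply: cvgMr; apply: cvg_expr; rewrite ger0_norm; lra.
  - exact: cvg_cst.
(* Now 2 y >= 1, so m u is at least n and [bernoulli_le] leaves at most 1 / (n + 1). *)
rewrite -leNgt => y2.
apply: (squeeze_cvgr (f := cst 0) (h := @harmonic R)).
- apply: nearW => n; apply/andP; split.
    by have /andP[] := step_approx_ge0_le1 n y01.
  apply: le_trans (bernoulli_le _ (h n)) _.
  rewrite /harmonic /= lef_pV2 ?posrE //; last first.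
    by rewrite ltr_pwDl // mulr_ge0 // exprn_ge0.
  rewrite -natr1 addrC lerD2l e -mulrA ler_peMr // -expr2 -exprM.
  by apply: exprn_ege1; lra.
- exact: cvg_cst.
- exact: cvg_harmonic.
Qed.

(** * Compactly supported measures are determined by their moments *)

Section Rintegral_sum.
Context d (T : measurableType d) (R : realType) (mu : {measure set T -> \bar R}).
Variables (D : set T) (mD : measurable D) (I : Type) (f : I -> T -> R).
Hypothesis intf : forall i, mu.-integrable D (EFin \o f i).

Lemma integrable_EFin_sum (s : seq I) :
  mu.-integrable D (EFin \o (fun x => \sum_(i <- s) f i x)).
Proof.
rewrite (_ : _ \o _ = fun x => (\sum_(i <- s) (EFin \o f i) x)%E); last first.
  by apply/funext => x /=; rewrite sumEFin.
exact: integrable_sum.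
Qed.

Lemma Rintegral_sum (s : seq I) :
  \int[mu]_(x in D) (\sum_(i <- s) f i x) = \sum_(i <- s) \int[mu]_(x in D) f i x.
Proof.
elim: s => [|i s IH].
  rewrite big_nil; under eq_Rintegral do rewrite big_nil.
  by rewrite Rintegral_cst // mul0r.
rewrite big_cons -IH; under eq_Rintegral do rewrite big_cons.
by rewrite RintegralD //; exact: integrable_EFin_sum.
Qed.

End Rintegral_sum.

(* [L >= 2 |x - t|] keeps the argument of [step_approx] in [0, 1]; the threshold
   1/2 is at [x = t]. *)
Definition step_poly (R : realType) (t L : R) n : {poly R} :=
  (1 - ((2^-1)%:P + L^-1 *: ('X - t%:P)) ^+ (2 * n)) ^+ (n * 4 ^ n).

Lemma step_polyE (R : realType) (t L : R) n x :
  (step_poly t L n).[x] = step_approx n (2^-1 + L^-1 * (x - t)).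
Proof. by rewrite /step_poly /step_approx !hornerE. Qed.

Section step_poly.
Context (R : realType) (M t x : R).
Hypotheses (M1 : 1 <= M) (xM : `|x| <= M).
Let L := 2 * (M + `|t|).
Let y := 2^-1 + L^-1 * (x - t).

Let L0 : 0 < L.
Proof. by rewrite mulr_gt0 // ltr_pwDl // (lt_le_trans ltr01). Qed.

Let y01 : 0 <= y <= 1.
Proof.
have : `|L^-1 * (x - t)| <= 2^-1.
  rewrite normrM normfV (gtr0_norm L0) ler_pdivrMl // /L.
  by rewrite mulrAC divff // mul1r (le_trans (ler_normB _ _)) // lerD2r.
by rewrite ler_norml /y => /andP[? ?]; apply/andP; split; lra.
Qed.

Lemma step_poly_ge0_le1 n : 0 <= (step_poly t L n).[x] <= 1.
Proof. by rewrite step_polyE; exact: step_approx_ge0_le1. Qed.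

Lemma cvg_step_poly :
  (step_poly t L n).[x] @[n --> \oo] --> (\1_(`]-oo, t[ : set R) x : R).
Proof.
under eq_cvg do rewrite step_polyE.
have -> : \1_(`]-oo, t[ : set R) x = if y < 2^-1 then 1 else 0 :> R.
  rewrite indicE mem_setE in_itv/= gtrDl pmulr_rlt0 ?invr_gt0 // subr_lt0.
  by case: (x < t).
exact: cvg_step_approx.
Qed.

End step_poly.

Section compact_moments.
Context (R : realType) (nu : borel_finite_measure R) (M : R).
Hypothesis nuM : nu (~` `[- M, M]) = 0%E.

Lemma integrable_expr n :
  nu.-integrable setT (EFin \o (fun x : R => x ^+ n)).
Proof.
apply: (bounded_integrable_full (measurable_itv _) nuM (C := M ^+ n)).
  exact: exprn_measurable.
move=> x /=; rewrite in_itv/= -ler_norml => xM; rewrite normrX.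
by rewrite lerXn2r // nnegrE // (le_trans _ xM).
Qed.

Lemma integrable_coef_expr (p : {poly R}) i :
  nu.-integrable setT (EFin \o (fun x : R => p`_i * x ^+ i)).
Proof.
have := integrableZl measurableT p`_i (integrable_expr i).
by apply: eq_integrable => //= x _; rewrite EFinM.
Qed.

Lemma integrable_horner (p : {poly R}) :
  nu.-integrable setT (EFin \o horner p).
Proof.
have := @integrable_EFin_sum _ _ _ nu setT measurableT _ _
  (fun i : 'I_(size p) => integrable_coef_expr p i) (index_enum _).
by apply: eq_integrable => //= x _; rewrite horner_coef.
Qed.

Lemma Rintegral_horner (p : {poly R}) :
  \int[nu]_x p.[x] = \sum_(i < size p) p`_i * \int[nu]_x x ^+ i.
Proof.
under eq_Rintegral do rewrite horner_coef.
rewrite (@Rintegral_sum _ _ _ nu setT measurableT _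
  (fun (i : 'I_(size p)) (x : R) => p`_i * x ^+ i)); last first.
  by move=> i; exact: integrable_coef_expr.
by apply: eq_bigr => i _; rewrite RintegralZl //; exact: integrable_expr.
Qed.

(** Dominated convergence with majorant 1: the step polynomials stay in [0, 1] on [[- M, M]], which
    carries [nu]. *)
Lemma cvg_Rintegral_step_poly : 1 <= M -> forall t : R,
  \int[nu]_x (step_poly t (2 * (M + `|t|)) n).[x] @[n --> \oo]
    --> fine (nu `]-oo, t[%classic).
Proof.
move=> M1 t; have mA := measurable_itv `[- M, M].
rewrite (_ : fine _ = \int[nu]_(x in `[- M, M]) \1_(`]-oo, t[ : set R) x); last first.
  rewrite (Rintegral_full mA nuM).
    by rewrite /Rintegral integral_indic // setIT.
  apply: (bounded_integrable_full mA nuM (C := 1)) => //.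
  by move=> x _; rewrite ger0_norm // indicE; case: (x \in _).
under eq_cvg => n do rewrite -(Rintegral_full mA nuM (integrable_horner _)).
apply: (dominated_cvg_Rintegral mA (g := cst 1)).
- by move=> n; exact: measurable_poly.
- exact: measurable_indic.
- apply: measurable_bounded_integrable => //.
    by rewrite ltey_eq fin_num_measure.
  exact: bounded_cst.
- move=> n x /=; rewrite in_itv/= -ler_norml => xM.
  by have /andP[? ?] := step_poly_ge0_le1 t M1 xM n; rewrite ger0_norm.
- by move=> x /=; rewrite in_itv/= -ler_norml; exact: cvg_step_poly.
Qed.

End compact_moments.

(** The number [a] stands for the mass of an additional atom at 1, all of whose moments equal [a].
    Equality of moments extends to polynomials by linearity and then to rays along the step
    polynomials. *)
Lemma moments_rays (R : realType) (nu1 nu2 : borel_finite_measure R) (M a : R) :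
  1 <= M -> nu1 (~` `[- M, M]) = 0%E -> nu2 (~` `[- M, M]) = 0%E ->
  (forall n, a + \int[nu1]_x x ^+ n = \int[nu2]_x x ^+ n) ->
  forall t, a * \1_(`]-oo, t[ : set R) 1 + fine (nu1 `]-oo, t[%classic) = fine (nu2 `]-oo, t[%classic).
Proof.
move=> M1 nu1M nu2M mom t.
have mom_poly (p : {poly R}) : a * p.[1] + \int[nu1]_x p.[x] = \int[nu2]_x p.[x].
  rewrite (Rintegral_horner nu1M) (Rintegral_horner nu2M) horner_coef mulr_sumr -big_split /=.
  by apply: eq_bigr => i _; rewrite -mom expr1n mulr1 mulrDr mulrC.
(* The atom sits inside [[- M, M]], so the step polynomials also converge there. *)
have c1 : `|1 : R| <= M by rewrite normr1.
have h2 := cvg_Rintegral_step_poly nu2M M1 (t := t).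
rewrite -(cvg_lim (@Rhausdorff R) h2); apply/esym/cvg_lim; first exact: Rhausdorff.
under eq_cvg => n do rewrite -mom_poly.
apply: cvgD; last exact: cvg_Rintegral_step_poly.
by apply: cvgMr; exact: cvg_step_poly.
Qed.

(** Open left rays are stable under intersection, generate the Borel sets and exhaust the line along
    [g], so they determine a finite measure. *)
Lemma rays_borel_eq (R : realType) (nu1 nu2 : borel_finite_measure R) :
  (forall t : R, fine (nu1 `]-oo, t[%classic) = fine (nu2 `]-oo, t[%classic)) ->
  borel_eq nu1 nu2.
Proof.
move=> rays A mA; pose g n : set R := `]-oo, n%:R[%classic.
apply: (@measure_unique _ R (measurableTypeR R) (@RGenInftyO.G R) g _ _ _ _ nu1 nu2 _ _ A mA).
- exact: RGenInftyO.measurableE.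
- move=> _ _ [x ->] [y ->]; exists (Num.min x y).
  apply/seteqP; split=> z; rewrite /setI /= !in_itv/= lt_min; [by move=> [-> ->] | by move=> /andP[]].
- by move=> n; exists n%:R.
- apply/seteqP; split=> // x _; exists (Num.truncn `|x|).+1 => //.
  by rewrite /g /= in_itv/= (le_lt_trans (ler_norm x)) // truncnS_gt.
- move=> _ [t ->]; have := congr1 EFin (rays t).
  by rewrite !fineK ?fin_num_measure //; exact: measurable_itv.
- move=> n; rewrite ltey_eq fin_num_measure //; exact: measurable_itv.
Qed.

(** * Representing triplets *)

(** The function is continuous on the open set where x differs from 1, and the remaining single
    point is harmless. *)
Lemma measurable_inv_1subx (R : realType) :
  measurable_fun setT (fun x : measurableTypeR R => 1 / (1 - x)).
Proof.
have cV (x : R) : x != 1 -> (1 / (1 - y) @[y --> x] --> 1 / (1 - x)).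
  move=> x1; apply: cvgM; first exact: cvg_cst.
  apply: cvgV; first by rewrite subr_eq0 eq_sym.
  by apply: cvgB; [exact: cvg_cst|exact: cvg_id].
have -> : setT = [set 1] `|` ~` [set 1] :> set (measurableTypeR R).
  by rewrite setUv.
apply/measurable_funU; [by []|exact: measurableC|split].
  exact: measurable_fun_set1.
apply: open_continuous_measurable_fun.
  exact/closed_openC/accessible_closed_set1/hausdorff_accessible/Rhausdorff.
by move=> x; rewrite inE /= => x1; apply: cV; exact/eqP.
Qed.

Section compact_Qfun.
Context (R : realType) (nu : borel_finite_measure R) (M : R).
Hypothesis nuM : nu (~` `[- M, M]) = 0%E.

Lemma integrable_geom n :
  nu.-integrable setT (EFin \o (fun x : R => \sum_(i < n) x ^+ i)).
Proof. by apply: integrable_EFin_sum => // i; exact: integrable_expr nuM i. Qed.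

Lemma integrable_Qfun n : nu.-integrable setT (EFin \o @Qfun R n).
Proof.
elim: n => [|n IH].
  apply: (eq_integrable _ (cst 0%E)) => //; last exact: integrable0.
  by move=> x _ /=; rewrite Qfun0.
have := integrableD measurableT IH (integrable_geom n).
by apply: eq_integrable => // x _ /=; rewrite QfunS.
Qed.

End compact_Qfun.

Lemma triplet_support_bounded (R : realType) (gamma : nat -> R) b c nu :
  representing_triplet gamma b c nu ->
  exists2 M : R, 1 <= M & closed_support nu `<=` `[- M, M].
Proof.
case=> _ /compact_bounded [M [_ hM]] _ _; exists (Num.max 1 (M + 1)).
  by rewrite le_max lexx.
move=> x /hM /= h; rewrite in_itv/= -ler_norml; apply: h.
by rewrite lt_max ltrDl ltr01 orbT.
Qed.

Section triplet.
Context (R : realType) (gamma : nat -> R) (b c : R) (nu : borel_finite_measure R).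
Hypothesis trip : representing_triplet gamma b c nu.

Lemma triplet_null : exists2 M : R, 1 <= M & nu (~` `[- M, M]) = 0%E.
Proof.
have [M M1 sM] := triplet_support_bounded trip; exists M => //.
by apply/closed_support_subP => //; exact: interval_closed.
Qed.

Lemma triplet_diff n : gamma n.+1 - gamma n =
  b + c * (2 * n%:R + 1) + \int[nu]_x \sum_(i < n) x ^+ i.
Proof.
have [M _ nuM] := triplet_null; have [_ _ _ g] := trip; rewrite (g n.+1) (g n).
under [X in _ + X - _]eq_Rintegral do rewrite QfunS.
rewrite RintegralD //; last 2 first.
- exact: integrable_Qfun nuM n.
- exact: integrable_geom nuM n.
by rewrite -natr1; ring.
Qed.

Lemma triplet_diff2 n :
  (gamma n.+2 - gamma n.+1) - (gamma n.+1 - gamma n) = 2 * c + \int[nu]_x x ^+ n.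
Proof.
have [M _ nuM] := triplet_null; rewrite !triplet_diff.
under [X in _ + X - _]eq_Rintegral do rewrite big_ord_recr.
rewrite RintegralD //; last 2 first.
- exact: integrable_geom nuM n.
- exact: integrable_expr nuM n.
by rewrite -natr1; ring.
Qed.

End triplet.

(** * Measures on [0, 1[ *)

(** The Archimedean step behind three sign facts: c <= 0, no mass on [1, +oo[, and d >= 0. *)
Lemma natr_bounded_le0 (R : archiRealFieldType) (m K : R) :
  (forall n : nat, n%:R * m <= K) -> m <= 0.
Proof.
move=> h; rewrite leNgt; apply/negP => m0.
have := h (Num.truncn (K / m)).+1; apply/negP; rewrite -ltNge -ltr_pdivrMr //.
exact: truncnS_gt.
Qed.

Section unit_interval.
Context (R : realType) (nu : borel_finite_measure R).
Hypotheses (nu01 : nu (~` `[0, 1[) = 0%E) (nuL1 : inv_1subx_L1 nu).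
Let D : set (measurableTypeR R) := `[0, 1[%classic.
Let mD : measurable D. Proof. exact: measurable_itv. Qed.
Let D1 x : D x -> x != 1.
Proof. by rewrite /D /= in_itv/= => /andP[_ x1]; rewrite lt_eqF. Qed.
Let D_ge0 x : D x -> 0 <= x. Proof. by rewrite /D /= in_itv/= => /andP[]. Qed.
Let D_gt0 x : D x -> 0 < 1 - x.
Proof. by rewrite /D /= in_itv/= subr_gt0 => /andP[]. Qed.
Let D_expr n x : D x -> 0 <= x ^+ n <= 1.
Proof.
by rewrite /D /= in_itv/= => /andP[x0 /ltW x1]; rewrite exprn_ge0 // exprn_ile1.
Qed.

Lemma unit_null : nu (~` `[- 1, 1]) = 0%E.
Proof.
apply/eqP; rewrite -measure_le0 -nu01; apply: le_measure.
- by rewrite inE; apply: measurableC.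
- by rewrite inE; apply: measurableC.
- apply: subsetC => x /=; rewrite !in_itv/= => /andP[x0 x1].
  by rewrite (le_trans _ x0) ?ltW // oppr_lt0.
Qed.

Lemma integrable_inv : nu.-integrable D (EFin \o (fun x : R => 1 / (1 - x))).
Proof. exact: integrableS measurableT mD _ nuL1. Qed.

(** On [0, 1[ the factor x^n is in [0, 1], so 1 / (1 - x) dominates. *)
Lemma integrable_expr_inv n :
  nu.-integrable D (EFin \o (fun x : R => x ^+ n / (1 - x))).
Proof.
apply: (le_integrable mD _ _ integrable_inv).
  apply/measurable_EFinP; under eq_fun do rewrite -[X in _ * X]div1r.
  apply: measurable_funM; first exact: exprn_measurable.
  by apply: measurable_funS (@measurable_inv_1subx R).
move=> x Dx; rewrite lee_fin !normrM normr1; apply: ler_wpM2r => //.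
by have /andP[? ?] := D_expr n Dx; rewrite ger0_norm.
Qed.

(** The geometric sum absorbs one factor 1 - x: the integrand is the sum of x^i / (1 - x) over i <
    n. *)
Lemma integrable_sub_expr_inv2 n :
  nu.-integrable D (EFin \o (fun x : R => (1 - x ^+ n) / (1 - x) ^+ 2)).
Proof.
have := @integrable_EFin_sum _ _ _ nu D mD _ _ integrable_expr_inv (iota 0 n).
apply: eq_integrable => // x; rewrite inE => Dx /=; congr (_%:E).
rewrite -mulr_suml -[n in iota 0 n]subn0 -/(index_iota 0 n) big_mkord geom_sumE ?D1 //.
by rewrite expr2 invfM mulrA.
Qed.

(** Links the two representations: the term linear in n is exactly the shift between b and d. *)
Lemma Rintegral_Qfun n : \int[nu]_x Qfun n x =
  n%:R * \int[nu]_(x in `[0, 1[) (1 / (1 - x))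
  - \int[nu]_(x in `[0, 1[) ((1 - x ^+ n) / (1 - x) ^+ 2).
Proof.
rewrite -(Rintegral_full mD nu01 (integrable_Qfun unit_null n)).
rewrite -(RintegralZl _ mD integrable_inv) -RintegralB //; last 2 first.
- by apply: (@eq_integrable _ _ _ nu _ mD _ _ _ (integrableZl mD n%:R integrable_inv)).
- exact: integrable_sub_expr_inv2.
by apply: eq_Rintegral => x; rewrite inE => Dx; rewrite QfunE ?D1 // mul1r.
Qed.

Lemma cvg_Rintegral_expr_inv :
  \int[nu]_(x in `[0, 1[) (x ^+ n / (1 - x)) @[n --> \oo] --> (0 : R).
Proof.
rewrite -[X in _ --> X](_ : \int[nu]_(x in D) 0 = 0); last first.
  by rewrite Rintegral_cst // mul0r.
apply: (dominated_cvg_Rintegral mD (g := fun x : R => 1 / (1 - x))).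
- by move=> n; apply/measurable_EFinP; exact: measurable_int (integrable_expr_inv n).
- exact: measurable_cst.
- exact: integrable_inv.
- move=> n x Dx; have /andP[? ?] := D_expr n Dx.
  by rewrite ger0_norm ?ler_wpM2r ?mulr_ge0 // invr_ge0 ltW // D_gt0.
- move=> x Dx; rewrite -[X in _ --> X](mul0r (1 - x)^-1).
  apply: cvgM; last exact: cvg_cst.
  by apply: cvg_expr; rewrite ger0_norm ?D_ge0 // -subr_gt0 D_gt0.
Qed.

Lemma Rintegral_expr_invS n : \int[nu]_(x in `[0, 1[) (x ^+ n.+1 / (1 - x))
  <= \int[nu]_(x in `[0, 1[) (x ^+ n / (1 - x)).
Proof.
apply: le_Rintegral => //; do ?exact: integrable_expr_inv.
move=> x Dx; rewrite ler_wpM2r ?invr_ge0 ?(ltW (D_gt0 Dx)) //.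
rewrite exprS ler_piMl ?exprn_ge0 ?D_ge0 //.
by rewrite -subr_ge0 ltW // D_gt0.
Qed.

Lemma Rintegral_frac_diff n :
  \int[nu]_(x in `[0, 1[) ((1 - x ^+ n.+1) / (1 - x) ^+ 2)
  - \int[nu]_(x in `[0, 1[) ((1 - x ^+ n) / (1 - x) ^+ 2)
  = \int[nu]_(x in `[0, 1[) (x ^+ n / (1 - x)).
Proof.
rewrite -RintegralB //; do ?exact: integrable_sub_expr_inv2.
apply: eq_Rintegral => x; rewrite inE => Dx.
have x1 : 1 - x != 0 by rewrite gt_eqF ?D_gt0.
by rewrite (exprS x); field.
Qed.

End unit_interval.

(** * Consequences of the integral representation *)

Section integral_rep.
Context (R : realType) (gamma : nat -> R) (d : R) (nu : borel_finite_measure R).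
Hypothesis rep : integral_rep gamma d nu.

Lemma rep_diff n :
  gamma n.+1 - gamma n = d - \int[nu]_(x in `[0, 1[) (x ^+ n / (1 - x)).
Proof.
have [nu01 nuL1 g] := rep; rewrite -Rintegral_frac_diff // (g n.+1) (g n).
by rewrite -natr1; ring.
Qed.

Lemma rep_nondecreasing : nondecreasing_seq (fun n => gamma n.+1 - gamma n).
Proof.
have [nu01 nuL1 _] := rep; apply/nondecreasing_seqP => n.
by rewrite !rep_diff lerD2l lerN2 Rintegral_expr_invS.
Qed.

(** Recovers d from gamma alone, whence the uniqueness of d. *)
Lemma rep_cvg : gamma n.+1 - gamma n @[n --> \oo] --> d.
Proof.
have [nu01 nuL1 _] := rep; rewrite -[X in _ --> X]subr0.
under eq_cvg do rewrite rep_diff.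
by apply: cvgB; [exact: cvg_cst|exact: cvg_Rintegral_expr_inv].
Qed.

Lemma rep_diff_le n : gamma n.+1 - gamma n <= d.
Proof.
have [nu01 _ _] := rep; rewrite rep_diff gerBl; apply: Rintegral_ge0 => x /=.
by rewrite in_itv/= => /andP[x0 x1]; rewrite mulr_ge0 ?exprn_ge0 // invr_ge0 subr_ge0 ltW.
Qed.

(** Summing the differences gives gamma_n <= gamma_0 + n d; a negative d would drive this below any
    lower bound. *)
Lemma rep_d_ge0 : has_lbound (range gamma) -> 0 <= d.
Proof.
move=> [l lg]; rewrite -oppr_le0; apply: (@natr_bounded_le0 _ _ (gamma 0%N - l)) => n.
have h : gamma n <= gamma 0%N + n%:R * d.
  elim: n => [|n IH]; first by rewrite mul0r addr0.
  by have := rep_diff_le n; rewrite -natr1; lra.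
have : l <= gamma n by apply: lg; exists n.
by lra.
Qed.

Lemma rep_closed_support : closed_support nu `<=` `[0, 1].
Proof.
have [nu01 _ _] := rep; apply/closed_support_subP; first exact: interval_closed.
apply/eqP; rewrite -measure_le0 -nu01; apply: le_measure.
- by rewrite inE; apply: measurableC.
- by rewrite inE; apply: measurableC.
- apply: subsetC => x /=; rewrite !in_itv/= => /andP[x0 x1].
  by rewrite x0 ltW.
Qed.

Lemma rep_triplet :
  representing_triplet gamma (d - \int[nu]_(x in `[0, 1[) (1 / (1 - x))) 0 nu.
Proof.
have [nu01 nuL1 g] := rep; split=> //.
- apply: (subclosed_compact _ (@segment_compact R 0 1)).
    by apply: closed_bigI => G [].
  exact: rep_closed_support.
- apply/eqP; rewrite -measure_le0 -nu01; apply: le_measure.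
  + by rewrite inE.
  + by rewrite inE; apply: measurableC.
  + by move=> x /= ->; rewrite in_itv/= ltxx andbF.
- by move=> n; rewrite Rintegral_Qfun // g; ring.
Qed.

(** On sum-zero vectors the part of gamma_(i+j) affine in i + j disappears, as does the 1 in 1 -
    x^(i+j); what remains under the integral is a square. *)
Lemma rep_real_form_ge0 k (a : 'I_k -> R) : \sum_(i < k) a i = 0 ->
  0 <= \sum_(i < k) \sum_(j < k) gamma (i + j)%N * (a i * a j).
Proof.
have [nu01 nuL1 g] := rep; move=> a0.
have mD : measurable (`[0, 1[%classic : set (measurableTypeR R)).
  exact: measurable_itv.
pose w n x : R := (1 - x ^+ n) / (1 - x) ^+ 2.
have intw i j : nu.-integrable `[0, 1[
    (EFin \o (fun x : R => a i * a j * w (i + j)%N x)).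
  have := integrableZl mD (a i * a j) (integrable_sub_expr_inv2 nuL1 (i + j)%N).
  by apply: eq_integrable => // x _; rewrite EFinM.
have -> : \sum_(i < k) \sum_(j < k) gamma (i + j)%N * (a i * a j) =
    - \sum_(i < k) \sum_(j < k) \int[nu]_(x in `[0, 1[) (a i * a j * w (i + j)%N x).
  (* A summand in which one index occurs only through a sum-zero factor vanishes: [lin] removes
     gamma_0 + i d, and [z] removes j d after exchanging the sums. *)
  have lin (u v : 'I_k -> R) : \sum_(j < k) v j = 0 ->
    \sum_(i < k) \sum_(j < k) u i * v j = 0.
    by move=> v0; rewrite big1 // => i _; rewrite -mulr_sumr v0 mulr0.
  rewrite -[LHS]addr0 -[X in _ + X](lin (fun i => - (gamma 0%N + i%:R * d) * a i) a a0).
  have z : \sum_(i < k) \sum_(j < k) - (a i) * (j%:R * d * a j) = 0.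
    by rewrite exchange_big /=; under eq_bigr do under eq_bigr do rewrite mulrC;
       apply: lin; rewrite sumrN a0 oppr0.
  rewrite -[LHS]addr0 -[X in _ + X]z -!big_split /= -sumrN; apply: eq_bigr => i _.
  rewrite -!big_split /= -sumrN; apply: eq_bigr => j _.
  rewrite RintegralZl //; last exact: integrable_sub_expr_inv2.
  by rewrite g natrD; ring.
have intw2 i : nu.-integrable `[0, 1[
    (EFin \o (fun x : R => \sum_(j < k) a i * a j * w (i + j)%N x)).
  exact: integrable_EFin_sum.
rewrite -[X in - X](_ : \int[nu]_(x in `[0, 1[)
   (\sum_(i < k) \sum_(j < k) a i * a j * w (i + j)%N x) = _); last first.
  rewrite Rintegral_sum //; apply: eq_bigr => i _.
  by rewrite Rintegral_sum.
rewrite -mulN1r -RintegralZl //; last exact: integrable_EFin_sum.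
apply: Rintegral_ge0 => x _.
suff -> : -1 * (\sum_(i < k) \sum_(j < k) a i * a j * w (i + j)%N x) =
  ((\sum_(i < k) a i * x ^+ i) / (1 - x)) ^+ 2 by exact: sqr_ge0.
rewrite mulN1r expr_div_n (expr2 (\sum_(_ < _) _)) big_distrlr /= mulr_suml -sumrN.
(* The contribution of the constant 1 in the numerator of [w]. *)
have z : \sum_(i < k) \sum_(j < k) a i * (a j / (1 - x) ^+ 2) = 0.
  by rewrite big1 // => i _; rewrite -mulr_sumr -mulr_suml a0 mul0r mulr0.
rewrite -[RHS]subr0 -[X in _ = _ - X]z -sumrB; apply: eq_bigr => i _.
rewrite mulr_suml -sumrN -sumrB; apply: eq_bigr => j _.
by rewrite /w exprD; ring.
Qed.

End integral_rep.

(** * From real to complex quadratic forms *)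

Lemma Re_sum (R : rcfType) (I : Type) (s : seq I) (F : I -> R[i]) :
  complex.Re (\sum_(i <- s) F i) = \sum_(i <- s) complex.Re (F i).
Proof. exact: raddf_sum. Qed.

Lemma Im_sum (R : rcfType) (I : Type) (s : seq I) (F : I -> R[i]) :
  complex.Im (\sum_(i <- s) F i) = \sum_(i <- s) complex.Im (F i).
Proof. exact: raddf_sum. Qed.

(** For lambda = a + i b the form is the sum of the real forms at a and at b, and both vectors have
    sum zero. Its imaginary part cancels because gamma_(i+j) is symmetric in i and j. *)
Lemma cond_pos_def_real (R : realType) (gamma : nat -> R) :
  (forall k (a : 'I_k.+1 -> R), \sum_(i < k.+1) a i = 0 ->
    0 <= \sum_(i < k.+1) \sum_(j < k.+1) gamma (i + j)%N * (a i * a j)) ->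
  cond_pos_def gamma.
Proof.
move=> pos k l l0; pose a i := complex.Re (l i); pose b i := complex.Im (l i).
have a0 : \sum_i a i = 0 by rewrite -Re_sum l0.
have b0 : \sum_i b i = 0 by rewrite -Im_sum l0.
rewrite lecE /= !Re_sum !Im_sum.
under eq_bigr do rewrite Im_sum.
under [X in 0 <= X]eq_bigr do rewrite Re_sum.
apply/andP; split.
  rewrite (_ : \sum_(i < _) _ = \sum_(i < k.+1) \sum_(j < k.+1) gamma (i + j)%N * (b i * a j) -
     \sum_(i < k.+1) \sum_(j < k.+1) gamma (i + j)%N * (a i * b j)).
    rewrite [X in X - _]exchange_big /= subr_eq0; apply/eqP.
    by do 2!apply: eq_bigr => ? _; rewrite addnC (mulrC (b _)).
  rewrite -sumrB; apply: eq_bigr => i _; rewrite -sumrB; apply: eq_bigr => j _.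
  by rewrite /a /b; case: (l i) => x y; case: (l j) => z t /=; ring.
rewrite (_ : \sum_(i < _) _ = \sum_(i < k.+1) \sum_(j < k.+1) gamma (i + j)%N * (a i * a j) +
     \sum_(i < k.+1) \sum_(j < k.+1) gamma (i + j)%N * (b i * b j)).
  by rewrite addr_ge0 // pos.
rewrite -big_split; apply: eq_bigr => i _; rewrite -big_split; apply: eq_bigr => j _.
by rewrite /a /b; case: (l i) => x y; case: (l j) => z t /=; ring.
Qed.

(** * From triplets to the integral representation *)

Lemma triplet_rep (R : realType) (gamma : nat -> R) (b c : R)
    (nu : borel_finite_measure R) :
  representing_triplet gamma b c nu ->
  closed_support nu `<=` [set x | 0 <= x] ->
  has_ubound (range (fun n => gamma n.+1 - gamma n)) ->
  [/\ c = 0, inv_1subx_L1 nu &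
    integral_rep gamma (b + \int[nu]_(x in `[0, 1[) (1 / (1 - x))) nu].
Proof.
move=> trip supp0 [K hK].
have [c0 _ nu1 g] := trip; have [M M1 nuM] := triplet_null trip.
pose A : set (measurableTypeR R) := [set x : R | 0 <= x].
have mA : measurable A by apply: closed_measurable; exact: closed_ge.
have nuA : nu (~` A) = 0%E by apply/closed_support_subP => //; exact: closed_ge.
have ub n : b + c * (2 * n%:R + 1) + \int[nu]_x \sum_(i < n) x ^+ i <= K.
  by rewrite -(triplet_diff trip); apply: hK; exists n.
have geom0 n : 0 <= \int[nu]_x \sum_(i < n) x ^+ i.
  rewrite -(Rintegral_full mA nuA (integrable_geom nuM n)).
  by apply: Rintegral_ge0 => x Ax; apply: sumr_ge0 => i _; exact: exprn_ge0.
(* The term 2 n c would make the differences grow linearly, the integrals being nonnegative. *)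
have cE : c = 0.
  apply/eqP; rewrite eq_le c0 andbT; apply: (@natr_bounded_le0 _ _ (K - b)) => n.
  have := ub n; have := geom0 n; have := mulr_ge0 (ler0n R n) c0; lra.
have {}ub n : \int[nu]_x \sum_(i < n) x ^+ i <= K - b by have := ub n; rewrite cE; lra.
pose B : set (measurableTypeR R) := `[1, +oo[%classic.
have mB : measurable B by exact: measurable_itv.
(* The geometric sum dominates n times the indicator of [B] on [A], so n nu(B) <= K - b for all
   n. *)
have nuB : nu B = 0%E.
  have : fine (nu B) <= 0.
    apply: (@natr_bounded_le0 _ _ (K - b)) => n; apply: le_trans (ub n).
    have intB : nu.-integrable setT (EFin \o (\1_B : R -> R)).
      apply: (bounded_integrable_full mA nuA (C := 1)) => //.
      by move=> x _; rewrite ger0_norm // indicE; case: (x \in _).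
    have -> : n%:R * fine (nu B) = \int[nu]_(x in A) (n%:R * \1_B x).
      rewrite RintegralZl //; last exact: integrableS intB.
      by rewrite (Rintegral_full mA nuA intB) /Rintegral integral_indic // setIT.
    rewrite -(Rintegral_full mA nuA (integrable_geom nuM n)).
    apply: le_Rintegral => //.
    - have intB' : nu.-integrable A (EFin \o (\1_B : R -> R)).
        exact: integrableS intB.
      have := integrableZl mA n%:R intB'.
      by apply: eq_integrable => // x _; rewrite EFinM.
    - by apply: integrableS (integrable_geom nuM n).
    - move=> x Ax; rewrite indicE; case: (boolP (x \in B)) => xB /=.
        by rewrite mulr1 ge1_le_geom_sum //; move: xB; rewrite inE /B /= in_itv/= andbT.
      by rewrite mulr0; apply: sumr_ge0 => i _; exact: exprn_ge0.
  by move=> m0; apply/eqP; rewrite -measure_le0 -(fineK (fin_num_measure nu _ mB)) lee_fin.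
pose D : set (measurableTypeR R) := `[0, 1[%classic.
have mD : measurable D by exact: measurable_itv.
(* A point off [D] is either negative or in [B]. *)
have nu01 : nu (~` D) = 0%E.
  apply/negligibleP; first exact: measurableC.
  apply: (@negligibleS _ _ _ nu (~` A `|` B)); last first.
    by apply: negligibleU; apply/negligibleP => //; exact: measurableC.
  move=> x; rewrite /D /A /B /setC /setU /= !in_itv/= andbT.
  case: (leP 0 x) => x0 /=; last by left.
  by case: (ltP x 1) => x1 /= n01; [case: n01|right].
have limE x : D x -> limn (fun n => (\sum_(i < n) x ^+ i)%:E) = (1 / (1 - x))%:E.
  rewrite /D /= in_itv/= => /andP[x0 x1]; apply/cvg_lim => //.
  apply: cvg_EFin; [exact: nearW|rewrite [X in X --> _]/=].
  have x1' : x != 1 by rewrite lt_eqF.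
  under eq_cvg do rewrite /= (geom_sumE _ x1').
  apply: cvgM; last exact: cvg_cst.
  rewrite -[X in _ --> X]subr0; apply: cvgB; first exact: cvg_cst.
  by apply: cvg_expr; rewrite ger0_norm.
have mgeom n : measurable_fun D (fun x : measurableTypeR R => (\sum_(i < n) x ^+ i)%:E).
  by apply: measurable_int (integrableS measurableT mD _ (integrable_geom nuM n)).
have D_ge0 x : D x -> 0 <= x by rewrite /D /= in_itv/= => /andP[].
have L1 : inv_1subx_L1 nu.
  apply: (integrable_full mD nu01); first exact: measurable_inv_1subx.
  apply/integrableP; split.
    by apply/measurable_EFinP; apply: measurable_funS (@measurable_inv_1subx R).
  apply: (@le_lt_trans _ _ (K - b)%:E); last exact: ltry.
  rewrite (eq_integral (fun x : measurableTypeR R => limn (fun n => (\sum_(i < n) x ^+ i)%:E))); last first.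
    move=> x; rewrite inE => Dx; rewrite limE //= ger0_norm //.
    by move: Dx; rewrite /D /= in_itv/= => /andP[_ x1]; rewrite divr_ge0 // subr_ge0 ltW.
  (* The partial geometric sums increase to 1 / (1 - x) and each has integral at most K - b, so the
     limit does too. *)
  have cvgI : (\int[nu]_(x in D) (\sum_(i < n) x ^+ i)%:E @[n --> \oo] -->
      \int[nu]_(x in D) limn (fun n => (\sum_(i < n) x ^+ i)%:E))%E.
    apply: cvg_monotone_convergence => //.
      by move=> n x Dx; rewrite lee_fin; apply: sumr_ge0 => i _; rewrite exprn_ge0 // D_ge0.
    move=> x Dx; suff nd : nondecreasing_seq (fun n => \sum_(i < n) x ^+ i).
      by move=> m n mn; rewrite lee_fin; exact: nd.
    by apply/nondecreasing_seqP => n; rewrite big_ord_recr lerDl exprn_ge0 // D_ge0.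
  rewrite -(cvg_lim _ cvgI) //; apply: lime_le; first by apply/cvg_ex; eexists; apply: cvgI.
  apply: nearW => n; rewrite -[leLHS]fineK ?lee_fin; last first.
    exact: integrable_fin_num (integrableS measurableT mD _ (integrable_geom nuM n)).
  by apply: le_trans (ub n); rewrite -(Rintegral_full mD nu01 (integrable_geom nuM n)).
split => //; split => // n; rewrite g Rintegral_Qfun // cE; ring.
Qed.

(** * Uniqueness of the measure *)

Lemma borel_eq_closed_support (R : realType) (nu1 nu2 : borel_finite_measure R) :
  borel_eq nu1 nu2 -> closed_support nu1 = closed_support nu2.
Proof.
move=> nu12; rewrite /closed_support; congr bigcap; apply/seteqP.
by split=> F /= [cF F0]; split=> //; rewrite -F0 nu12 //;
  apply: measurableC; exact: closed_measurable.
Qed.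

(* [gamma] determines [2 c delta_1 + nu] through its second differences; a
   triplet [(b0, 0, nu0)] with [nu0] carried by [[0, 1[] leaves no mass for
   the atom at 1. *)
Lemma rep_triplet_unique (R : realType) (gamma : nat -> R) d0 nu0 b c nu :
  integral_rep gamma d0 nu0 -> representing_triplet gamma b c nu ->
  borel_eq nu nu0.
Proof.
move=> rep trip; have trip0 := rep_triplet rep.
have [nu0D _ _] := rep; have [c0 _ _ _] := trip.
have [M1 M11 nuM] := triplet_support_bounded trip.
have [M2 M21 nu0M] := triplet_support_bounded trip0.
(* A common interval for both measures, as [moments_rays] requires. *)
pose M := Num.max M1 M2.
have M_ge1 : 1 <= M by rewrite le_max M11.
have {}nuM : nu (~` `[- M, M]) = 0%E.
  apply/closed_support_subP; first exact: interval_closed.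
  apply: (subset_trans nuM) => x /=; rewrite !in_itv/= -!ler_norml => /le_trans; apply.
  by rewrite le_max lexx.
have {}nu0M : nu0 (~` `[- M, M]) = 0%E.
  apply/closed_support_subP; first exact: interval_closed.
  apply: (subset_trans nu0M) => x /=; rewrite !in_itv/= -!ler_norml => /le_trans; apply.
  by rewrite le_max lexx orbT.
have mom n : 2 * c + \int[nu]_x x ^+ n = \int[nu0]_x x ^+ n.
  by rewrite -(triplet_diff2 trip) (triplet_diff2 trip0) mulr0 add0r.
have rays := moments_rays M_ge1 nuM nu0M mom.
suff cE : c = 0.
  by apply: rays_borel_eq => t; rewrite -rays cE mulr0 mul0r add0r.
(* The moment of order 0. *)
have mass : 2 * c + fine (nu setT) = fine (nu0 setT).
  have mom0 (mu : borel_finite_measure R) : \int[mu]_x x ^+ 0 = fine (mu setT).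
    by under eq_Rintegral do rewrite expr0; rewrite Rintegral_cst // mul1r.
  by rewrite -!mom0.
(* The open ray ending at 1 misses the atom, so both measures agree on it, and it carries all of
   [nu0]. With [mass] this gives 2 c + nu(R) = nu(]-oo, 1[) <= nu(R), hence c <= 0. *)
have ray1 : fine (nu0 setT) = fine (nu `]-oo, 1[%classic).
  have <- : fine (nu0 `]-oo, 1[%classic) = fine (nu `]-oo, 1[%classic).
    by rewrite -rays indicE mem_setE in_itv/= ltxx mulr0 add0r.
  congr fine; apply/eqP; rewrite eq_le [X in _ && X]le_measure ?inE // andbT.
  have mI : measurable (`]-oo, 1[%classic : set (measurableTypeR R)).
    exact: measurable_itv.
  rewrite -(setUv (`]-oo, 1[%classic : set (measurableTypeR R))).
  apply: (le_trans (measureU2 _ mI (measurableC mI))).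
  rewrite -[leRHS]adde0 leeD2l // -nu0D le_measure ?inE //; first exact: measurableC.
    by apply: measurableC.
  by apply: subsetC => x /=; rewrite !in_itv/= => /andP[].
have : fine (nu `]-oo, 1[%classic) <= fine (nu setT).
  by rewrite fine_le ?fin_num_measure // le_measure ?inE.
by move: c0 mass; rewrite ray1; lra.
Qed.

Theorem theorem2p3p3 (R : realType) (gamma : nat -> R)
    (gamma_lb : has_lbound (range gamma)) :
  [/\ (* (i) <-> (ii) *)
      cpd_bounded_supp gamma <->
        exists (nu : borel_finite_measure R) (d : R), integral_rep gamma d nu,
      (* (iii) *)
      cpd_bounded_supp gamma ->
        forall (b c : R) (nu : borel_finite_measure R),
          representing_triplet gamma b c nu ->
          [/\ c = 0,
              inv_1subx_L1 nu,
              integral_rep gamma (b + \int[nu]_(x in `[0, 1[) (1 / (1 - x))) nu &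
              forall (d' : R) (nu' : borel_finite_measure R),
                integral_rep gamma d' nu' ->
                d' = b + \int[nu]_(x in `[0, 1[) (1 / (1 - x)) /\
                borel_eq nu' nu] &
      (* (iv) *)
      forall (d : R) (nu : borel_finite_measure R),
        integral_rep gamma d nu ->
        [/\ 0 <= d,
            nondecreasing_seq (fun n => gamma n.+1 - gamma n),
            (fun n => gamma n.+1 - gamma n) @ \oo --> d &
            representing_triplet gamma
              (d - \int[nu]_(x in `[0, 1[) (1 / (1 - x))) 0 nu]].
Proof.
split.
- split=> [[_ ub [b [c [nu [trip supp]]]]]|[nu [d rep]]].
    exists nu, (b + \int[nu]_(x in `[0, 1[) (1 / (1 - x))).
    by have [] := triplet_rep trip supp ub.
  split.
  + by apply: cond_pos_def_real => k a; exact: rep_real_form_ge0 rep _ _.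
  + by exists d => _ [n _ <-]; exact: rep_diff_le rep n.
  + exists (d - \int[nu]_(x in `[0, 1[) (1 / (1 - x))), 0, nu; split.
      exact: rep_triplet.
    apply: (subset_trans (rep_closed_support rep)) => x /=.
    by rewrite in_itv/= => /andP[].
- move=> [_ ub [b0 [c0 [nu0 [trip0 supp0]]]]] b c nu trip.
  have [_ _ rep0] := triplet_rep trip0 supp0 ub.
  (* The support condition is known for the triplet in the hypothesis only; uniqueness of the
     measure transfers it to the given one. *)
  have nuE := rep_triplet_unique rep0 trip.
  have supp : closed_support nu `<=` [set x | 0 <= x].
    by rewrite (borel_eq_closed_support nuE).
  have [cE L1 rep] := triplet_rep trip supp ub.
  split=> // d' nu' rep'; split.
    (* Both constants are the limit of the same differences of gamma. *)
    rewrite -(cvg_lim (@Rhausdorff R) (rep_cvg rep')).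
    by apply: cvg_lim; [exact: Rhausdorff|exact: rep_cvg rep].
  by move=> B mB; rewrite (rep_triplet_unique rep' trip).
- move=> d nu rep; split.
  + exact: rep_d_ge0 rep gamma_lb.
  + exact: rep_nondecreasing rep.
  + exact: rep_cvg rep.
  + exact: rep_triplet.
Qed.
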